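(* Let $L$ be a first-order language, $M$ an $L$-structure, and $\phi(x,y)$ an $L$-formula. Let $X = S_{\phi^{*}}(M)$. The following are equivalent. (a) Whenever $f\in 2^{X}$ lies in the closure, with respect to the pointwise convergence topology (equivalently, the product topology on $2^{X}$ with $2=\{0,1\}$ discrete), of the set of functions $X\to 2$ given by the formulas $\phi(a,y)$ for $a\in M$, then $f$ is continuous, and so is given by a $\phi^{*}$-formula over $M$. (b) $\phi(x,y)$ does not have the order property in $M$.
   Context: Here $x,y$ are (finite tuples of) variables, and ''$a\in M$'' means that $a$ is a tuple from $M$ of the appropriate length. $\phi^{*}(y,x)$ denotes the same formula as $\phi(x,y)$ but with $y$ regarded as the variable and $x$ as the parameter variable. $S_{\phi^{*}}(M)$ is the space of complete $\phi^{*}$-types over $M$ in the variable $y$, that is, maximal consistent (with the elementary diagram of $M$) sets of formulas of the form $\phi(a,y)$ or $\neg\phi(a,y)$ with $a\in M$. It carries the usual compact Hausdorff (Stone) topology. A $\phi^{*}$-formula over $M$ is a finite Boolean combination of formulas $\phi(a,y)$ with $a\in M$; these formulas pick out exactly the clopen subsets of $S_{\phi^{*}}(M)$. A $\phi^{*}$-formula $\psi(y)$ over $M$ (in particular $\phi(a,y)$ with $a\in M$) gives the continuous function $X\to 2$ sending $q$ to the truth value of $\psi(b)$ for some/any realization $b$ of $q$ in an elementary extension of $M$. $\phi(x,y)$ has the order property in $M$ if there exist $a_{i},b_{i}$ in $M$ for $i<\omega$ such that either for all $i,j<\omega$: $M\models\phi(a_{i},b_{j})$ iff $i\leq j$; or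 for all $i,j<\omega$: $M\models\neg\phi(a_{i},b_{j})$ iff $i\leq j$. *)

(* Defs.v *)
From HB Require Import structures.
From mathcomp Require Import all_boot.
From mathcomp Require Import all_classical topology.

Set Implicit Arguments.
Unset Strict Implicit.
Unset Printing Implicit Defensive.

Local Open Scope classical_set_scope.

(** One-sorted first-order languages; constants are 0-ary function symbols. *)
Record language := Language {
  func : Type;
  func_arity : func -> nat;
  pred_sym : Type;
  pred_arity : pred_sym -> nat }.

(** Terms and formulas are well scoped: [term L V] and [formula L V] have their
    free variables in the type [V], and a quantifier binds the extra variable
    [None : option V].  Disjunction, implication and universal quantification
    are the usual abbreviations. *)
Inductive term (L : language) (V : Type) : Type :=
| Var of V
| App (f : func L) of ('I_(func_arity f) -> term L V).

Inductive formula (L : language) (V : Type) : Type :=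
| Eq of term L V & term L V
| Rel (r : pred_sym L) of ('I_(pred_arity r) -> term L V)
| Neg of formula L V
| And of formula L V & formula L V
| Exists of formula L (option V).

Fixpoint rename_term (L : language) (V W : Type) (s : V -> W)
    (t : term L V) : term L W :=
  match t with
  | Var x => Var L (s x)
  | App f ts => App (fun i => rename_term s (ts i))
  end.

Fixpoint rename (L : language) (V W : Type) (s : V -> W)
    (psi : formula L V) : formula L W :=
  match psi with
  | Eq t u => Eq (rename_term s t) (rename_term s u)
  | Rel r ts => Rel (fun i => rename_term s (ts i))
  | Neg psi1 => Neg (rename s psi1)
  | And psi1 psi2 => And (rename s psi1) (rename s psi2)
  | Exists psi1 => Exists (rename (omap s) psi1)
  end.

Record structure (L : language) := Structure {
  carrier :> Type;
  carrier_inhabited : inhabited carrier;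
  func_interp : forall f : func L, ('I_(func_arity f) -> carrier) -> carrier;
  pred_interp : forall r : pred_sym L, ('I_(pred_arity r) -> carrier) -> Prop }.

Fixpoint eval_term (L : language) (N : structure L) (V : Type) (e : V -> N)
    (t : term L V) : N :=
  match t with
  | Var x => e x
  | App f ts => func_interp (fun i => eval_term e (ts i))
  end.

Fixpoint sat (L : language) (N : structure L) (V : Type) (e : V -> N)
    (psi : formula L V) : Prop :=
  match psi with
  | Eq t u => eval_term e t = eval_term e u
  | Rel r ts => pred_interp (fun i => eval_term e (ts i))
  | Neg psi1 => ~ sat e psi1
  | And psi1 psi2 => sat e psi1 /\ sat e psi2
  | Exists psi1 => exists c : N, sat (fun o => oapp e c o) psi1
  end.

Definition sumfun (A B C : Type) (f : A -> C) (g : B -> C) (v : A + B) : C :=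
  match v with inl a => f a | inr b => g b end.

(** A tuple of [n] variables is indexed by ['I_n] and a tuple of elements of [M]
    is a function ['I_n -> M].  Parameters (constants naming elements of [M])
    are variables taken from [M] itself, interpreted in a model [N] through a
    map [h : M -> N]. *)
Section LocalTypes.
Context (L : language) (M : structure L) (n m : nat).
Context (phi : formula L ('I_n + 'I_m)).

Definition elementary_diagram : set (formula L M) :=
  [set psi | sat (fun c : M => c) psi].

Definition instance_of (a : 'I_n -> M) : formula L (M + 'I_m) :=
  rename (sumfun (fun i => inl (a i)) inr) phi.

Definition realizes (N : structure L) (h : M -> N) (b : 'I_m -> N)
    (p : set (formula L (M + 'I_m))) : Prop :=
  elementary_diagram `<=` [set psi | sat h psi] /\
  p `<=` [set psi | sat (sumfun h b) psi].

Definition consistent (p : set (formula L (M + 'I_m))) : Prop :=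
  exists (N : structure L) (h : M -> N) (b : 'I_m -> N), realizes h b p.

Definition literals : set (formula L (M + 'I_m)) :=
  [set instance_of a | a in setT] `|` [set Neg (instance_of a) | a in setT].

Definition complete_type (p : set (formula L (M + 'I_m))) : Prop :=
  [/\ p `<=` literals, consistent p &
      forall q, q `<=` literals -> consistent q -> p `<=` q -> q = p].

Inductive phistar_formula : formula L (M + 'I_m) -> Prop :=
| PhistarInstance a : phistar_formula (instance_of a)
| PhistarNeg psi : phistar_formula psi -> phistar_formula (Neg psi)
| PhistarAnd psi1 psi2 : phistar_formula psi1 -> phistar_formula psi2 ->
    phistar_formula (And psi1 psi2).

Definition order_property : Prop :=
  exists (a : nat -> 'I_n -> M) (b : nat -> 'I_m -> M),
    (forall i j, sat (sumfun (a i) (b j)) phi <-> i <= j) \/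
    (forall i j, sat (sumfun (a i) (b j)) (Neg phi) <-> i <= j).

End LocalTypes.

Definition type_space (L : language) (M : structure L) (n m : nat)
    (phi : formula L ('I_n + 'I_m)) : Type :=
  {p : set (formula L (M + 'I_m)) | complete_type phi p}.

HB.instance Definition _ L M n m phi := gen_eqMixin (@type_space L M n m phi).
HB.instance Definition _ L M n m phi :=
  gen_choiceMixin (@type_space L M n m phi).

(** The Stone topology.  Only the literals contribute nonempty sets
    [{q | psi \in q}] to this subbase. *)
Definition stone_subbase (L : language) (M : structure L) (n m : nat)
    (phi : formula L ('I_n + 'I_m)) : set (set (type_space M phi)) :=
  [set U | exists psi, U = [set q | proj1_sig q psi]].

HB.instance Definition _ L M n m phi :=
  isSubBaseTopological.Build (@type_space L M n m phi)
    (@stone_subbase L M n m phi) idfun.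

(** The function [X -> 2] given by [psi]: the truth value of [psi] at a
    realization of [q].  For a [phistar_formula] it is the same at all of them. *)
Definition truth_value (L : language) (M : structure L) (n m : nat)
    (phi : formula L ('I_n + 'I_m)) (psi : formula L (M + 'I_m))
    (q : type_space M phi) : bool :=
  `[< exists (N : structure L) (h : M -> N) (b : 'I_m -> N),
        realizes h b (proj1_sig q) /\ sat (sumfun h b) psi >].

(* Main.v *)
(** Call [R a b] the truth of [phi(a, b)] in [M]; the types realized in [M] are
    dense in [X].

    Without the order property, let [f] be approximated on finite sets by the
    [phi(a, y)].  By an Erdős–Makkai style argument, the restriction of [f] to
    the types realized in [M] is decided by finitely many [phi(a, y)], so it
    agrees there with a Boolean combination [psi] of them.  If [f] and [psi]
    differed at some [q], then choosing in turn [a_i] which approximates [f] on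
    [q, b_0, ..., b_(i-1)], and [b_i] in [M] with [psi(b_i) = psi(q)] and with
    the same [phi]-relations to [a_0, ..., a_i] as [q], would produce the order
    property.  So [f = psi] everywhere.

    With the order property, an ultralimit of the [phi(a_i, y)] disagrees with
    every [psi] at the limit type of the [b_j], which is realized in an
    ultrapower of [M]. *)
Require Import Defs.
From HB Require Import structures.
From mathcomp Require Import all_boot.
From mathcomp Require Import all_classical topology.

Set Implicit Arguments.
Unset Strict Implicit.
Unset Printing Implicit Defensive.

Local Open Scope classical_set_scope.

(** * Ladders in a binary relation, built by alternating choices *)

Lemma dependent_choice_seq (T : Type) (P : seq T -> T -> Prop) :
  (forall s, exists x, P s x) -> exists u : nat -> T, forall k, P (mkseq u k) (u k).
Proof.
move=> /choice[F FP].
pose st := fix st k := if k is l.+1 then rcons (st l) (F (st l)) else [::].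
exists (fun k => F (st k)) => k; suff -> : mkseq (fun k => F (st k)) k = st k by [].
by elim: k => // k IH; rewrite mkseqS IH.
Qed.

Lemma all_mkseqP (T : Type) (p : pred T) (u : nat -> T) (k : nat) :
  reflect (forall i, i < k -> p (u i)) (all p (mkseq u k)).
Proof.
rewrite /mkseq all_map; apply: (iffP allP) => /= H i.
  by move=> ik; apply: H; rewrite mem_iota.
by rewrite mem_iota add0n; exact: H.
Qed.

(** Choose [a_k] failing [S] with [b_0, ..., b_(k-1)], then [b_k] satisfying [S] with
    [a_0, ..., a_k]. The predicates [p] and [q] keep both hypotheses applicable at every stage. *)
Lemma ladder (A B : Type) (S : A -> B -> bool) (p : pred A) (q : pred B) :
    (forall t, all q t -> exists2 a, p a & all (fun b => ~~ S a b) t) ->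
    (forall s, all p s -> exists2 b, q b & all (fun a => S a b) s) ->
  exists (a : nat -> A) (b : nat -> B), forall i j, S (a i) (b j) = (i <= j).
Proof.
move=> Ha Hb.
pose good (s : seq (A * B)) := all (fun x => p x.1 && q x.2) s.
have [u uP] : exists u : nat -> A * B, forall k, good (mkseq u k) ->
    [/\ p (u k).1 && q (u k).2, S (u k).1 (u k).2,
        all (fun x => ~~ S (u k).1 x.2) (mkseq u k) &
        all (fun x => S x.1 (u k).2) (mkseq u k)].
  apply: (@dependent_choice_seq _ (fun s x => good s ->
    [/\ p x.1 && q x.2, S x.1 x.2, all (fun y => ~~ S x.1 y.2) s &
        all (fun y => S y.1 x.2) s])) => s.
  (* The choice must be total, so sequences that are not good receive an arbitrary pair; [gu] shows
     that they never occur. *)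
  have [gs|] := boolP (good s); last first.
    have [a _ _] := Ha [::] isT; have [b _ _] := Hb [::] isT.
    by move=> _; exists (a, b).
  have [|a pa Sa] := Ha (map snd s).
    by rewrite all_map; apply: sub_all gs => x /andP[].
  have [|b qb /=] := Hb (a :: map fst s).
    by rewrite /= pa all_map; apply: sub_all gs => x /andP[].
  rewrite !all_map in Sa *; case/andP => Sab Sb.
  by exists (a, b) => _; rewrite pa qb; split.
have gu k : good (mkseq u k).
  by elim: k => // k IH; rewrite mkseqS /good all_rcons -/(good _) IH; case: (uP k IH) => ->.
exists (fst \o u), (snd \o u) => i j /=; case: ltngtP => [ij|ji|->].
- have [_ _ _ /all_mkseqP H] := uP j (gu j); exact: H.
- have [_ _ /all_mkseqP H _] := uP i (gu i); exact/negbTE/H.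
- by have [_ -> _ _] := uP j (gu j).
Qed.

Definition approximated (A B : Type) (R : A -> B -> bool) (f : B -> bool) :=
  forall t, exists a, all (fun b => R a b == f b) t.

Definition agree (A B : Type) (R : A -> B -> bool) (s : seq A) (b b' : B) :=
  all (fun a => R a b == R a b') s.

(** The Boolean [c] merges the two alternatives of the order property: [true] for the relation,
    [false] for its negation. *)
Definition ordered (A B : Type) (R : A -> B -> bool) :=
  exists (c : bool) (a : nat -> A) (b : nat -> B),
    forall i j, R (a i) (b j) = ((i <= j) == c).

(* If no finite [s] decides [f], an ultrafilter of pairs [(b', b'')] with
   [f b' = true] and [f b'' = false] that agree on every finite [s] assigns to
   each [a] a common limit value [g a]; one of the two classes of [g] still
   approximates [f], and it is played against the [b''], resp. the [b']. *)
Lemma approximated_unordered (A B : Type) (R : A -> B -> bool) (f : B -> bool) :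
  approximated R f -> ~ ordered R ->
  exists s, forall b b', agree R s b b' -> f b = f b'.
Proof.
move=> Rf nord; apply: contrapT => /forallNP nos.
pose D s := [set x : B * B | [/\ f x.1, ~~ f x.2 & agree R s x.1 x.2]].
have DF : Filter (filter_from [set: seq A] D).
  apply: filter_from_filter; first by exists [::].
  move=> s t _ _; exists (s ++ t) => // x [fx nfx].
  by rewrite /agree all_cat => /andP[sx tx]; split; split.
have [W [WU DW]] : exists W, UltraFilter W /\ filter_from [set: seq A] D `<=` W.
  apply: ultraFilterLemma; apply: filter_from_proper => s _.
  apply: contrapT => nDs; apply: (nos s) => b b' bb'.
  have b'b : agree R s b' b by apply: sub_all bb' => a; rewrite eq_sym.
  case fb: (f b); case fb': (f b') => //; case: nDs.
  - by exists (b, b'); split; rewrite //= fb'.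
  - by exists (b', b); split; rewrite //= fb.
have WD s : W (D s) by apply: DW; exists s.
pose g a := `[< W [set x | R a x.1] >].
have gW a : W [set x | R a x.1 = g a /\ R a x.2 = g a].
  have : W [set x | R a x.1 = g a].
    rewrite /g; case: asboolP => [//|nWa].
    have [//|] := in_ultra_setVsetC [set x | R a x.1] WU.
    by apply: filterS => x /= /negP/negbTE.
  move=> Wa; apply: filterS (filterI Wa (WD [:: a])) => x /= [<- [_ _]].
  by rewrite /agree /= andbT => /eqP <-.
have gWs (c : bool) s : all (fun a => g a == c) s ->
    W [set x | all (fun a => (R a x.1 == c) && (R a x.2 == c)) s].
  elim: s => [_|a s IH /= /andP[/eqP ga /IH Ws]]; first exact: filterE.
  apply: filterS (filterI (gW a) Ws) => x /= [[-> ->] ->].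
  by rewrite ga eqxx.
(* If the class [true] fails on some [t0], then any [a] approximating [f] on [t0 ++ t] lies in the
   class [false]. *)
have [c cf] : exists c : bool, forall t, exists2 a, g a == c & all (fun b => R a b == f b) t.
  have [H|] := pselect (forall t, exists2 a, g a == true & all (fun b => R a b == f b) t).
    by exists true.
  move=> /existsNP[t0 nt0]; exists false => t; have [a] := Rf (t0 ++ t).
  rewrite all_cat => /andP[at0 at_]; exists a => //.
  by case ga: (g a) => //; case: nt0; exists a; rewrite ?ga.
apply: nord; exists c.
pose S a b := R a b == c.
(* Where [f b = ~~ c], an [a] approximating [f] violates [S]. Conversely, finitely many [a] with
   limit value [c] all satisfy [S] at both entries of almost every pair, and one entry has [f]-value
   [~~ c]. *)
have [||a [b abP]] := @ladder _ _ S (fun a => g a == c) (fun b => f b == ~~ c).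
- move=> t ft; have [a ga aP] := cf t; exists a => //.
  have : all (fun b => (f b == ~~ c) && (R a b == f b)) t by rewrite all_predI ft aP.
  by apply: sub_all => b /andP[/eqP fb /eqP]; rewrite /S fb => ->; case: (c).
- move=> s gs.
  have [x [[f1 f2 _]] xs] := filter_ex (filterI (WD [::]) (gWs c s gs)).
  exists (if c then x.2 else x.1); first by case: (c); rewrite /= ?f1 ?(negbTE f2).
  by move: xs => /=; apply: sub_all =>  a /andP[]; rewrite /S; case: (c).
by exists a, b => i j; rewrite -abP /S; case: (R _ _); case: (c).
Qed.

Lemma sval_injective (T : Type) (P : T -> Prop) : injective (@sval T P).
Proof. by move=> u v; apply: eq_sig_hprop => x; exact: Prop_irrelevance. Qed.

(** * Renaming of variables and quantification over tuples *)

Lemma eval_rename_term (L : language) (N : structure L) (V W : Type) (s : V -> W)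
    (e : W -> N) (t : term L V) :
  eval_term e (rename_term s t) = eval_term (e \o s) t.
Proof. by elim: t => //= f ts IH; congr func_interp; apply: funext. Qed.

Lemma sat_rename (L : language) (N : structure L) (V : Type) (psi : formula L V) :
  forall (W : Type) (s : V -> W) (e : W -> N),
  sat e (rename s psi) <-> sat (e \o s) psi.
Proof.
elim: psi => {V} [V t u|V r ts|V psi IH|V psi1 IH1 psi2 IH2|V psi IH] W s e /=.
- by rewrite !eval_rename_term.
- by rewrite (_ : (fun i => _) = fun i => eval_term (e \o s) (ts i)) //;
    apply: funext => i; rewrite eval_rename_term.
- by rewrite IH.
- by rewrite IH1 IH2.
- split=> -[c] H; exists c; move: H; rewrite IH;
    by rewrite (_ : _ \o omap s = fun o => oapp (e \o s) c o) //;
    apply: funext => -[].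
Qed.

(** Binds the coordinates one at a time. Since [psi] depends on neither [N] nor [e], the existence
    of a tuple can be transferred between models. *)
Lemma exists_tuple (L : language) (m : nat) :
  forall (V : Type) (chi : formula L (V + 'I_m)),
  exists psi : formula L V, forall (N : structure L) (e : V -> N),
    sat e psi <-> exists b : 'I_m -> N, sat (sumfun e b) chi.
Proof.
elim: m => [|m IH] V chi.
  have no (T : Type) : 'I_0 -> T by case.
  exists (rename (sumfun id (no V)) chi) => N e.
  have E (b : 'I_0 -> N) : sumfun e b = e \o sumfun id (no V).
    by apply: funext => -[//|[]].
  rewrite sat_rename; split=> [H|[b]]; last by rewrite E.
  by exists (no N); rewrite E.
pose s (x : V + 'I_m.+1) : option V + 'I_m := match x with
  | inl v => inl (Some v)
  | inr i => if unlift ord0 i is Some j then inr j else inl None end.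
have [psi psiP] := IH _ (rename s chi).
exists (Exists psi) => N e /=; split=> [[c /psiP[b]]|[b H]].
  rewrite sat_rename => H; exists (fun i => if unlift ord0 i is Some j then b j else c).
  by move: H; congr sat; apply: funext => -[//|i] /=; case: unlift.
exists (b ord0); apply/psiP; exists (fun j => b (lift ord0 j)); rewrite sat_rename.
move: H; congr sat; apply: funext => -[//|i] /=.
by case: unliftP => [j ->|->].
Qed.

(** * Ultrapowers and the theorem of Łoś *)

Section Ultrapower.
Context (L : language) (M : structure L) (I : Type).
Context (U : set_system I) (UU : UltraFilter U).

Definition germ (g : I -> M) : set (I -> M) := [set h | U [set i | g i = h i]].

(** The quotient by equality [U]-almost everywhere, encoded by actual classes because [Eq] is
    interpreted as equality of elements. *)
Definition germs : Type := {C : set (I -> M) | exists g, C = germ g}.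

Definition to_germ (g : I -> M) : germs := exist _ (germ g) (ex_intro _ g erefl).

Definition germ_repr (C : germs) : I -> M := projT1 (cid (proj2_sig C)).

Lemma to_germ_eq (g h : I -> M) : to_germ g = to_germ h <-> U [set i | g i = h i].
Proof.
split=> [E|gh].
  have : germ h h by apply: filterE.
  by rewrite -[germ h]/(proj1_sig (to_germ h)) -E.
apply: sval_injective => /=; apply/seteqP; split=> k /= gk.
  by apply: filterS2 gh gk => i /= -> ->.
by apply: filterS2 gh gk => i /= -> ->.
Qed.

Lemma germ_reprK (C : germs) : to_germ (germ_repr C) = C.
Proof. by apply: sval_injective; rewrite /germ_repr; case: cid. Qed.

Lemma germ_reprE (g : I -> M) : U [set i | germ_repr (to_germ g) i = g i].
Proof. by apply/to_germ_eq; exact: germ_reprK. Qed.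

Lemma germs_inhabited : inhabited germs.
Proof. by have [x] := carrier_inhabited M; exact: (inhabits (to_germ (cst x))). Qed.

Definition ultrapower : structure L :=
  @Structure L germs germs_inhabited
    (fun f args => to_germ (fun i => func_interp (fun k => germ_repr (args k) i)))
    (fun r args => U [set i | pred_interp (fun k => germ_repr (args k) i)]).

(** Finitely many sets of [U] intersect in a set of [U]; this makes the interpretations independent
    of the representatives. *)
Lemma germ_repr_tuple (k : nat) (args : 'I_k -> I -> M) :
  U [set i | (fun j => germ_repr (to_germ (args j)) i) = args ^~ i].
Proof.
have : U [set i | forall j, germ_repr (to_germ (args j)) i = args j i].
  by apply: filter_forall => j; exact: germ_reprE.
by apply: filterS => i H; exact: funext.
Qed.

Lemma los_term (V : Type) (e : V -> I -> M) (t : term L V) :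
  eval_term (N := ultrapower) (to_germ \o e) t =
  to_germ (fun i => eval_term (e ^~ i) t).
Proof.
elim: t => // f ts IH.
rewrite -[LHS]/(@func_interp _ ultrapower f
  (fun k => eval_term (N := ultrapower) (to_germ \o e) (ts k))) (funext IH).
apply/to_germ_eq.
apply: filterS (germ_repr_tuple (fun k i => eval_term (e ^~ i) (ts k))) => i /=.
by move=> ->.
Qed.

Lemma los (V : Type) (psi : formula L V) : forall e : V -> I -> M,
  sat (N := ultrapower) (to_germ \o e) psi <-> U [set i | sat (e ^~ i) psi].
Proof.
elim: psi => {V} [V t u|V r ts|V psi IH|V psi1 IH1 psi2 IH2|V psi IH] e /=.
- by rewrite !los_term to_germ_eq.
- rewrite -[X in X <-> _]/(@pred_interp _ ultrapower r
    (fun k => eval_term (N := ultrapower) (to_germ \o e) (ts k))).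
  rewrite (funext (fun k => los_term e (ts k))) /=.
  have T := germ_repr_tuple (fun k i => eval_term (e ^~ i) (ts k)).
  by split=> H; apply: filterS2 T H => i /= ->.
- rewrite IH; split=> [nU|Un /(filterI Un)/filter_ex[i []//]].
  by have [//|] := in_ultra_setVsetC [set i | sat (e ^~ i) psi] UU.
- rewrite IH1 IH2; split=> [[H1 H2]|H]; first exact: filterI.
  by split; apply: filterS H => i [].
- have E (g : I -> M) : (fun o => oapp (to_germ \o e) (to_germ g) o) =
      to_germ \o (fun o => oapp e g o) by apply: funext => -[].
  have E' (g : I -> M) i : (fun o => oapp e g o i) =
      (fun o => oapp (e ^~ i) (g i) o) by apply: funext => -[].
  split=> [[c]|H].
    rewrite -(germ_reprK c) E IH; apply: filterS => i /= H.
    by exists (germ_repr c i); rewrite -E'.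
  (* Witnesses are chosen index by index, with [x0] as default at the indices that have none. *)
  have [x0] := carrier_inhabited M.
  pose Q i c := sat (fun o => oapp (e ^~ i) c o) psi.
  have [g gP] : {g : I -> M & forall i, (exists c, Q i c) -> Q i (g i)}.
    apply: (@choice _ _ (fun i x => (exists c, Q i c) -> Q i x)) => i.
    by have [[c cP]|] := pselect (exists c, Q i c); [exists c | exists x0].
  exists (to_germ g); rewrite E IH; apply: filterS H => i /= /gP.
  by rewrite E'.
Qed.

End Ultrapower.

(** * Local types, their realizations and truth values *)

Section LocalTypeSpace.
Context (L : language) (M : structure L) (n m : nat).
Context (phi : formula L ('I_n + 'I_m)).
Implicit Types (a : 'I_n -> M) (b : 'I_m -> M) (q : type_space M phi).

Local Notation holds := (fun a b => `[< sat (sumfun a b) phi >]).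
Local Notation value a := (truth_value (phi := phi) (instance_of phi a)).

Lemma sat_instance (N : structure L) (h : M -> N) (b : 'I_m -> N) a :
  sat (sumfun h b) (instance_of phi a) <-> sat (sumfun (h \o a) b) phi.
Proof.
rewrite sat_rename (_ : _ \o _ = sumfun (h \o a) b) //.
by apply: funext => -[].
Qed.

Lemma literal_instance a : literals phi (instance_of phi a).
Proof. by left; exists a. Qed.

Lemma literal_neg a : literals phi (Neg (instance_of phi a)).
Proof. by right; exists a. Qed.

Definition realized (N : structure L) (h : M -> N) (b : 'I_m -> N) :
    set (formula L (M + 'I_m)) :=
  literals phi `&` [set psi | sat (sumfun h b) psi].

(** Of each instance and its negation, one holds at [b]. A consistent [r] above this set cannot
    contain a literal false at [b], since it would also contain the opposite literal. *)
Lemma realized_complete (N : structure L) (h : M -> N) (b : 'I_m -> N) :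
  elementary_diagram (M := M) `<=` [set psi | sat h psi] ->
  complete_type phi (realized h b).
Proof.
move=> Mh; split=> [psi []//| |r rlit [N' [h' [b' [_ rN']]]] hr].
  by exists N, h, b; split=> // psi [].
apply/seteqP; split=> // psi rpsi; split; first exact: rlit.
have [[a _]|[a _]] := rlit _ rpsi; move: rpsi => /[swap] <- rpsi; apply: contrapT => nsat.
  by apply: (rN' (Neg (instance_of phi a))) (rN' _ rpsi); apply: hr; split; first exact: literal_neg.
apply: (rN' _ rpsi); apply: rN'; apply: hr; split; first exact: literal_instance.
exact: contrapT.
Qed.

Lemma realizes_eq (N : structure L) (h : M -> N) (b : 'I_m -> N)
    (p : set (formula L (M + 'I_m))) :
  complete_type phi p -> realizes h b p -> p = realized h b.
Proof.
move=> [plit _ pmax] [Mh ph]; apply/esym; apply: pmax => [psi []//||psi ppsi].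
  by exists N, h, b; split=> // psi [].
by split; [exact: plit | exact: ph].
Qed.

(** By [realizes_eq] all realizations of [q] satisfy the same instances, and this passes through
    Boolean connectives. *)
Lemma truth_valueP (psi : formula L (M + 'I_m)) q (N : structure L) (h : M -> N)
    (b : 'I_m -> N) :
  phistar_formula phi psi -> realizes h b (sval q) ->
  truth_value psi q <-> sat (sumfun h b) psi.
Proof.
move=> psiP qb; split=> [/asboolP[N' [h' [b' [qb' psib']]]]|psib]; last first.
  by apply/asboolP; exists N, h, b.
suff <- : sat (sumfun h' b') psi <-> sat (sumfun h b) psi by [].
elim: psiP {psib'} => [a|psi1 _ /= ->//|psi1 psi2 _ /= -> _ ->//].
have inst (N0 : structure L) (h0 : M -> N0) (b0 : 'I_m -> N0) :
    realizes h0 b0 (sval q) -> sval q (instance_of phi a) <-> sat (sumfun h0 b0) (instance_of phi a).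
  move=> /(realizes_eq (svalP q)) ->; split=> [[]//|H]; split=> //.
  exact: literal_instance.
by rewrite -(inst _ _ _ qb) -(inst _ _ _ qb').
Qed.

Lemma type_realization q :
  exists (N : structure L) (h : M -> N) (b : 'I_m -> N), realizes h b (sval q).
Proof. by have [] := svalP q. Qed.

Lemma truth_value_neg (psi : formula L (M + 'I_m)) q : phistar_formula phi psi ->
  truth_value (Neg psi) q = ~~ truth_value psi q.
Proof.
move=> psiP; have [N [h [b qb]]] := type_realization q.
have PN := PhistarNeg psiP.
by apply/idP/negP; rewrite (truth_valueP PN qb) (truth_valueP psiP qb).
Qed.

Lemma truth_value_and (psi1 psi2 : formula L (M + 'I_m)) q :
  phistar_formula phi psi1 -> phistar_formula phi psi2 ->
  truth_value (And psi1 psi2) q = truth_value psi1 q && truth_value psi2 q.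
Proof.
move=> P1 P2; have [N [h [b qb]]] := type_realization q.
have P12 := PhistarAnd P1 P2.
by apply/idP/andP; rewrite (truth_valueP P1 qb) (truth_valueP P2 qb) (truth_valueP P12 qb).
Qed.

Definition type_of (N : structure L) (h : M -> N) (b : 'I_m -> N)
    (Mh : elementary_diagram (M := M) `<=` [set psi | sat h psi]) : type_space M phi :=
  exist _ _ (realized_complete b Mh).

Lemma truth_value_type_of (psi : formula L (M + 'I_m)) (N : structure L) (h : M -> N)
    (b : 'I_m -> N) (Mh : elementary_diagram (M := M) `<=` [set psi | sat h psi]) :
  phistar_formula phi psi ->
  truth_value psi (type_of b Mh) <-> sat (sumfun h b) psi.
Proof. by move=> /truth_valueP; apply; split=> // chi []. Qed.

Definition point b : type_space M phi :=
  type_of (N := M) (h := id) b (@subset_refl _ (elementary_diagram (M := M))).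

Lemma truth_value_point (psi : formula L (M + 'I_m)) b : phistar_formula phi psi ->
  truth_value psi (point b) <-> sat (sumfun id b) psi.
Proof. exact: truth_value_type_of. Qed.

Lemma value_point a b : value a (point b) = holds a b.
Proof.
have P : phistar_formula phi (instance_of phi a) by exact: PhistarInstance.
by apply/idP/asboolP; rewrite (truth_value_point b P) sat_instance.
Qed.

(** * Density of the types realized in [M] *)

(** Otherwise the elementary diagram would contain the negation of the existential closure of [psi],
    which a realization of [q] refutes. *)
Lemma truth_value_sat (psi : formula L (M + 'I_m)) q : phistar_formula phi psi ->
  truth_value psi q -> exists b, sat (sumfun id b) psi.
Proof.
move=> psiP; have [N [h [b qb]]] := type_realization q.
rewrite (truth_valueP psiP qb) => satb.
have [chi chiP] := exists_tuple psi; apply/chiP; apply: contrapT => nchi.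
have [Mh _] := qb; apply: (Mh (Neg chi)) => //.
by apply/chiP; exists b.
Qed.

(** Each [a] in [s] is absorbed by conjoining to [psi] the literal on [a] that is true at [q]. *)
Lemma points_dense (s : seq ('I_n -> M)) : forall (psi : formula L (M + 'I_m)) q,
  phistar_formula phi psi -> truth_value psi q ->
  exists2 b, truth_value psi (point b) & all (fun a => holds a b == value a q) s.
Proof.
elim: s => [|a s IH] psi q psiP qpsi.
  have [b psib] := truth_value_sat psiP qpsi; exists b => //.
  exact/truth_value_point.
have Pa : phistar_formula phi (instance_of phi a) by exact: PhistarInstance.
pose lit := if value a q then instance_of phi a else Neg (instance_of phi a).
have Plit : phistar_formula phi lit by rewrite /lit; case: ifP => // _; exact: PhistarNeg.
have litE r : truth_value lit r = (value a r == value a q).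
  by rewrite /lit; case: (value a q) => //; rewrite ?truth_value_neg // eqbF_neg.
have [|b] := IH (And psi lit) q (PhistarAnd psiP Plit).
  by rewrite truth_value_and // litE eqxx qpsi.
rewrite truth_value_and // litE value_point => /andP[psib ab] sb.
by exists b => //=; rewrite ab.
Qed.

(** * Finitely decided functions as Boolean combinations *)

Lemma phistar_if (psi psi1 psi0 : formula L (M + 'I_m)) :
  phistar_formula phi psi -> phistar_formula phi psi1 -> phistar_formula phi psi0 ->
  exists2 chi, phistar_formula phi chi & forall q, truth_value chi q =
    if truth_value psi q then truth_value psi1 q else truth_value psi0 q.
Proof.
move=> P P1 P0; have NP := PhistarNeg P.
have A1 := PhistarAnd P (PhistarNeg P1); have A0 := PhistarAnd NP (PhistarNeg P0).
exists (And (Neg (And psi (Neg psi1))) (Neg (And (Neg psi) (Neg psi0)))) => [|q].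
  by apply: PhistarAnd; exact: PhistarNeg.
rewrite (truth_value_and _ (PhistarNeg A1) (PhistarNeg A0)) !truth_value_neg //.
rewrite (truth_value_and _ P (PhistarNeg P1)) (truth_value_and _ NP (PhistarNeg P0)).
by rewrite !truth_value_neg //; case: (truth_value psi q); rewrite /= negbK ?andbT.
Qed.

Lemma decided_phistar (s : seq ('I_n -> M)) : forall f : ('I_m -> M) -> bool,
  (forall b b', agree holds s b b' -> f b = f b') ->
  exists2 psi, phistar_formula phi psi & forall b, f b = truth_value psi (point b).
Proof.
elim: s => [|a s IH] f fs.
  have [x0] := carrier_inhabited M.
  pose inst := instance_of phi (fun=> x0).
  have P : phistar_formula phi inst by exact: PhistarInstance.
  have PF := PhistarAnd P (PhistarNeg P).
  have F b : truth_value (And inst (Neg inst)) (point b) = false.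
    by rewrite truth_value_and ?truth_value_neg ?andbN //; exact: PhistarNeg.
  case fx: (f (fun=> x0)).
    exists (Neg (And inst (Neg inst))) => [|b]; first exact: PhistarNeg.
    by rewrite truth_value_neg // F -[RHS]fx; exact: fs.
  by exists (And inst (Neg inst)) => // b; rewrite F -[RHS]fx; exact: fs.
(* [g c] depends only on the relations to [s] and equals [f] on the tuples with [holds a b = c], so
   [f] is a case distinction on [a]. *)
pose g (c : bool) b := `[< exists b', [/\ holds a b' = c, agree holds s b b' & f b'] >].
have gs c b b' : agree holds s b b' -> g c b = g c b'.
  move=> bb'; apply: asbool_equiv_eq; split=> -[b2 [ab2 sb2 fb2]]; exists b2; split=> //.
    have : all (fun a => (holds a b == holds a b') && (holds a b == holds a b2)) s.
      by rewrite all_predI; apply/andP.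
    by apply: sub_all => a0 /andP[/eqP-> ].
  have : all (fun a => (holds a b == holds a b') && (holds a b' == holds a b2)) s.
    by rewrite all_predI; apply/andP.
  by apply: sub_all => a0 /andP[/eqP-> ].
have fg b : f b = g (holds a b) b.
  apply/idP/asboolP => [fb|[b' [ab' sb' fb']]].
    by exists b; split=> //; apply/all_filterP; rewrite -[RHS]filter_predT; apply: eq_filter => ?; rewrite eqxx.
  by rewrite (fs b b') // /agree /= ab' eqxx.
have [psi1 P1 E1] := IH _ (gs true).
have [psi0 P0 E0] := IH _ (gs false).
have [chi chiP chiE] := phistar_if (PhistarInstance phi a) P1 P0.
exists chi => // b; rewrite chiE value_point -E1 -E0 fg.
by case: `[< _ >].
Qed.

(** * Stone topology and pointwise closure *)

Lemma stone_open (psi : formula L (M + 'I_m)) :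
  open [set q : type_space M phi | sval q psi].
Proof.
set A := [set q : type_space M phi | sval q psi].
exists [set A]; last by rewrite bigcup_set1.
by move=> _ ->; apply: finI_from1; exists psi.
Qed.

(** An instance and its negation are both literals, so each of the two truth values is taken on an
    open set. *)
Lemma truth_value_near (psi : formula L (M + 'I_m)) q : phistar_formula phi psi ->
  \forall r \near q, truth_value psi r = truth_value psi q.
Proof.
elim=> [a|chi chiP IH|chi1 chi2 P1 IH1 P2 IH2].
- have P : phistar_formula phi (instance_of phi a) by exact: PhistarInstance.
  have litE r : sval r (instance_of phi a) <-> value a r.
    have [N [h [b rb]]] := type_realization r.
    rewrite (truth_valueP P rb) (realizes_eq (svalP r) rb).
    by split=> [[]//|H]; split=> //; exact: literal_instance.
  have nlitE r : sval r (Neg (instance_of phi a)) <-> ~~ value a r.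
    have [N [h [b rb]]] := type_realization r.
    rewrite -truth_value_neg // (truth_valueP (PhistarNeg P) rb) (realizes_eq (svalP r) rb).
    by split=> [[]//|H]; split=> //; exact: literal_neg.
  have [aq|naq] := boolP (value a q).
    apply: filterS (open_nbhs_nbhs (conj (stone_open (instance_of phi a)) _)) => [r /litE ->//|].
    exact/litE.
  apply: filterS (open_nbhs_nbhs (conj (stone_open (Neg (instance_of phi a))) _)) => [r /nlitE/negbTE ->//|].
  exact/nlitE.
- by apply: filterS IH => r; rewrite !truth_value_neg // => ->.
- by apply: filterS2 IH1 IH2 => r; rewrite !truth_value_and // => -> ->.
Qed.

Lemma truth_value_continuous (psi : formula L (M + 'I_m)) : phistar_formula phi psi ->
  continuous (truth_value psi : type_space M phi -> bool).
Proof.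
move=> psiP q A /principal_filterP Aq.
by apply: filterS (truth_value_near q psiP) => r /= ->.
Qed.

(** Agreement with [f] at finitely many types defines a neighbourhood of [f] in the product
    topology. *)
Lemma closure_approximated (f : type_space M phi -> bool) :
  closure ([set value a | a in [set: 'I_n -> M]]
             : set {ptws type_space M phi -> bool}) f ->
  approximated (fun a q => value a q) f.
Proof.
move=> fcl t.
have ft : nbhs (f : {ptws type_space M phi -> bool})
    [set g | all (fun q => g q == f q) t].
  elim: t => [|q t IH]; first exact: filterE.
  have fq : nbhs (f : {ptws type_space M phi -> bool}) [set g | g q = f q].
    by have := @proj_continuous _ (fun=> bool) q f [set c | c = f q]; apply; exact/principal_filterP.
  by apply: filterS2 fq IH => g /= -> ->; rewrite eqxx.
by have [_ [[a _ <-]]] := fcl _ ft; exists a.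
Qed.

(** Density alone does not suffice, as [f] is not yet known to be continuous. A disagreement at [q]
    instead feeds a ladder of parameters with value [f q] at [q] and tuples with [f]-value
    [~~ f q]. *)
Lemma phistar_extension (f : type_space M phi -> bool) (psi : formula L (M + 'I_m)) :
  phistar_formula phi psi -> ~ ordered holds ->
  approximated (fun a q => value a q) f ->
  (forall b, f (point b) = truth_value psi (point b)) -> f = truth_value psi.
Proof.
move=> psiP nord fapp fpsi; apply: funext => q; apply: contrapT => /eqP fq; apply: nord.
exists (f q).
pose S a b := holds a b == f q.
have [||a [b abP]] := @ladder _ _ S (fun a => value a q == f q)
    (fun b => f (point b) == ~~ f q).
- move=> t tf; have [a /= /andP[aq]] := fapp (q :: map point t).
  rewrite all_map => at_; exists a => //.
  have : all (fun b => (f (point b) == ~~ f q) && (value a (point b) == f (point b))) t.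
    by rewrite all_predI; apply/andP.
  apply: sub_all => b /andP[/eqP fb]; rewrite value_point fb /S => /eqP ->.
  by case: (f q).
- move=> s sq.
  (* [chi] expresses that [psi] has the value [~~ f q], which it does at [q]. *)
  pose chi := if f q then Neg psi else psi.
  have chiP : phistar_formula phi chi by rewrite /chi; case: ifP => // _; exact: PhistarNeg.
  have chiE (r : type_space M phi) : truth_value chi r = (truth_value psi r == ~~ f q).
    by rewrite /chi; case: (f q); rewrite ?truth_value_neg //; case: (truth_value psi r).
  have [|b] := @points_dense s chi q chiP.
    by rewrite chiE; case: (f q) fq; case: (truth_value psi q).
  rewrite chiE -fpsi => fb sb; exists b => //.
  have : all (fun a => (value a q == f q) && (holds a b == value a q)) s.
    by rewrite all_predI; apply/andP.
  by apply: sub_all => a /andP[/eqP aq]; rewrite aq.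
by exists a, b => i j; rewrite -abP /S; case: `[< _ >]; case: (f q).
Qed.

Lemma order_propertyP : order_property M phi <-> ordered holds.
Proof.
split=> [[a [b [H|H]]]|[c [a [b H]]]].
- exists true, a, b => i j; rewrite eqb_id.
  by apply/asboolP/idP => /H.
- exists false, a, b => i j; rewrite eqbF_neg.
  apply/asboolP/negP => [s /H//|nij]; apply: contrapT => ns; exact/nij/H.
exists a, b; case: c H => H; [left|right] => i j; have := H i j.
  by rewrite eqb_id => <-; split=> /asboolP.
rewrite eqbF_neg /= => E; split=> [/asboolPn|ij]; first by rewrite E negbK.
by apply/asboolPn; rewrite E negbK.
Qed.

End LocalTypeSpace.

(** * Ultralimits and a discontinuous function from an ordered relation *)

Lemma asbool_ultralimit (I : Type) (U : set_system I) (v : I -> bool) (c : bool) :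
  ProperFilter U -> U [set i | v i = c] -> `[< U [set i | v i] >] = c.
Proof.
move=> UF; case: c => Uc; first exact/asboolP.
by apply/asboolPn => /(filterI Uc)/filter_ex[i [/= ->]].
Qed.

(* The ultralimit [f] of the [phi(a_i, y)] has the value [~~ c] at every
   [b_j], but the value [c] at the ultralimit of the types of the [b_j]; a
   [phistar_formula] cannot tell the latter from almost all [b_j]. *)
Lemma ordered_discontinuous (L : language) (M : structure L) (n m : nat)
    (phi : formula L ('I_n + 'I_m)) :
  ordered (fun (a : 'I_n -> M) (b : 'I_m -> M) => `[< sat (sumfun a b) phi >]) ->
  exists2 f : type_space M phi -> bool,
    closure ([set truth_value (instance_of phi a) | a in [set: 'I_n -> M]]
               : set {ptws type_space M phi -> bool}) f &
    forall psi, phistar_formula phi psi -> f <> truth_value psi.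
Proof.
move=> [c [a [b abP]]].
(* [U] contains all tails, so limits along it ignore finitely many indices. *)
have [U [UU oU]] := @ultraFilterLemma _ (\oo : set_system nat) _.
pose g i : type_space M phi -> bool := truth_value (instance_of phi (a i)).
pose f q := `[< U [set i | g i q] >].
exists f.
  have gf : {ptws, g @ U --> f}.
    apply/pointwise_cvgP => q A /principal_filterP Aq.
    suff Uq : U [set i | g i q = f q].
      have : U [set i | A (g i q)] by apply: filterS Uq => i /= ->.
      by [].
    have [Uq|] := in_ultra_setVsetC [set i | g i q] UU.
      by apply: filterS (Uq) => i /= ->; rewrite /f (asbool_ultralimit (c := true) _ Uq).
    move=> Uq; have {}Uq : U [set i | g i q = false].
      by apply: filterS Uq => i /= /negP/negbTE.
    by apply: filterS (Uq) => i /= ->; rewrite /f (asbool_ultralimit _ Uq).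
  move=> A /gf gA; have /filter_ex[i Ai] : U (g @^-1` A) by [].
  by exists (g i); split=> //; exists (a i).
move=> psi psiP fpsi.
have Pa i : phistar_formula phi (instance_of phi (a i)) by exact: PhistarInstance.
have gE i j : g i (point phi (b j)) = ((i <= j) == c) by rewrite /g value_point abP.
have fb j : f (point phi (b j)) = ~~ c.
  apply: asbool_ultralimit; apply: filterS (oU _ (nbhs_infty_gt j)) => i /= ji.
  by rewrite gE leqNgt ji; case: (c).
pose N := ultrapower M U.
pose h (x : M) : N := to_germ U (fun=> x).
(* The diagonal tuple, realizing in the ultrapower the limit of the types of the [b_j]. *)
pose binf (k : 'I_m) : N := to_germ U (fun j => b j k).
have Mh : elementary_diagram (M := M) `<=` [set chi | sat h chi].
  by move=> chi Mchi; apply/(los UU chi (fun x _ => x)); apply: filterE.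
pose p : type_space M phi := type_of phi binf Mh.
have pE chi : phistar_formula phi chi ->
    truth_value chi p = `[< U [set j | truth_value chi (point phi (b j))] >].
  move=> chiP.
  have E : sumfun h binf = to_germ U \o (fun v j => sumfun id (b j) v).
    by apply: funext => -[].
  apply/idP/asboolP; rewrite (truth_value_type_of binf Mh chiP) E los.
    by apply: filterS => j /= H; apply/(truth_value_point _ chiP).
  by apply: filterS => j /= /(truth_value_point _ chiP).
(* The limits come in the opposite order to [fb]: with [i] fixed, almost all [j] satisfy
   [i <= j]. *)
have fp : f p = c.
  apply: asbool_ultralimit; apply: filterE => i.
  rewrite /= /g pE //; apply: asbool_ultralimit.
  by apply: filterS (oU _ (nbhs_infty_ge i)) => j /= ij; rewrite -/(g i) gE ij; case: (c).
have : f p = ~~ c.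
  rewrite fpsi pE //; apply: asbool_ultralimit; apply: filterE => j.
  by rewrite -(fb j) fpsi.
by rewrite fp; case: (c).
Qed.

Unset Implicit Arguments.

Theorem proposition2p2 (L : language) (M : structure L) (n m : nat)
    (phi : formula L ('I_n + 'I_m)) :
  (forall f : type_space M phi -> bool,
     closure ([set truth_value (instance_of phi a) | a in [set: 'I_n -> M]]
                : set {ptws type_space M phi -> bool}) f ->
     continuous f /\
     exists psi : formula L (M + 'I_m),
       phistar_formula phi psi /\ f = truth_value psi)
  <-> ~ order_property M phi.
Proof.
rewrite order_propertyP; split=> [cl /ordered_discontinuous[f fcl nf]|nord f fcl].
  by have [_ [psi [psiP fpsi]]] := cl f fcl; exact: (nf psi).
have fapp := closure_approximated fcl.
(* Restricting to realized types puts both sides of the relation in [M], where the absence of the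
   order property applies. *)
have fMapp : approximated (fun a b => `[< sat (sumfun a b) phi >]) (f \o point phi).
  move=> t; have [a] := fapp (map (point phi) t).
  by rewrite all_map => at_; exists a; apply: sub_all at_ => b; rewrite /= value_point.
have [s sf] := approximated_unordered fMapp nord.
have [psi psiP fpsi] := decided_phistar sf.
have fE : f = truth_value psi := phistar_extension psiP nord fapp fpsi.
by split; [rewrite fE; exact: truth_value_continuous | exists psi].
Qed.
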